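(* Let $R$ be a $\ast$-ring. The following statements are equivalent: (1) $R$ is nil-$\ast$-reversible. (2) $l(a)=l(a^{\ast})=r(a)$ for all $a\in N(R)$.
   Context: All rings are associative with unity. A $\ast$-ring is a ring $R$ equipped with an involution $\ast$, i.e. a map $\ast:R\to R$ with $(x+y)^{\ast}=x^{\ast}+y^{\ast}$, $(xy)^{\ast}=y^{\ast}x^{\ast}$ and $(x^{\ast})^{\ast}=x$ for all $x,y\in R$. $N(R)$ is the set of nilpotent elements of $R$. A $\ast$-ring $R$ is nil-$\ast$-reversible if for all $a\in N(R)$ and $b\in R$, $ab=0$ implies $ab^{\ast}=b^{\ast}a=0$. For $a\in R$, $l(a)=\{x\in R: xa=0\}$ and $r(a)=\{x\in R: ax=0\}$. *)

(* Defs.v *)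
From HB Require Import structures.
From mathcomp Require Import all_boot all_algebra.
From mathcomp Require Import classical_sets.

Set Implicit Arguments.
Unset Strict Implicit.
Unset Printing Implicit Defensive.

Import GRing.Theory.
Local Open Scope classical_set_scope.
Local Open Scope ring_scope.

(* The base class is pzRingType rather than nzRingType: a ring is associative *)
(* and unital, and 1 != 0 is not required.                                    *)
HB.mixin Record isStarRing R of GRing.PzRing R := {
  star : R -> R;
  starD : {morph star : x y / x + y};
  starM : forall x y : R, star (x * y) = star y * star x;
  starK : involutive star
}.

#[short(type="starRingType")]
HB.structure Definition StarRing := { R of isStarRing R & GRing.PzRing R }.

Definition nilpotents (R : pzRingType) : set R :=
  [set a | exists2 n, (0 < n)%N & a ^+ n = 0].

Definition lann (R : pzRingType) (a : R) : set R := [set x | x * a = 0].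

Definition rann (R : pzRingType) (a : R) : set R := [set x | a * x = 0].

Definition nil_star_reversible (R : starRingType) : Prop :=
  forall a b : R, nilpotents a -> a * b = 0 ->
    a * star b = 0 /\ star b * a = 0.

(* Main.v *)
Require Import Defs.
From HB Require Import structures.
From mathcomp Require Import all_boot all_algebra.
From mathcomp Require Import classical_sets.

Import GRing.Theory.
Local Open Scope classical_set_scope.
Local Open Scope ring_scope.

(** Applying the involution to [x * y = 0] gives [star y * star x = 0], so
    [b \in lann (star a)] just means [a * star b = 0] (lemma [mulr_star_eq0]).

    If the ring is nil-star-reversible, then from [a * b = 0] with [a]
    nilpotent one gets [a * star b = 0], i.e. [b] lies in [lann (star a)];
    the same step started from [star b] leads back, whence
    [rann a = lann (star a)].  From [a * star x = 0] reversibility at [a] also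
    gives [x * a = 0].  The way back is different, because the hypothesis
    needs the nilpotent factor on the left: [x * a = 0] is turned into
    [star a * star x = 0], and reversibility is used at [star a], which is
    again nilpotent (lemma [nilpotents_star]).

    Conversely, if the three annihilators agree and [a * b = 0], then
    [b \in rann a = lann (star a)] says [a * star b = 0], and then
    [star b \in rann a = lann a] says [star b * a = 0]. *)

Lemma star0 (R : starRingType) : star (0 : R) = 0.
Proof. by apply: (addrI (star 0)); rewrite -starD !addr0. Qed.

(** Involutivity is what forces this: it puts [1] in the range of [star], so
    that [star 1], being neutral on that range, fixes [1]. *)
Lemma star1 (R : starRingType) : star (1 : R) = 1.
Proof. by rewrite -[LHS]mul1r -[X in X * _](starK 1) -starM mul1r starK. Qed.

Lemma starX (R : starRingType) (a : R) n : star (a ^+ n) = star a ^+ n.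
Proof. by elim: n => [|n IHn]; rewrite ?expr0 ?star1 // exprSr starM IHn exprS. Qed.

Lemma nilpotents_star (R : starRingType) (a : R) :
  nilpotents a -> nilpotents (star a).
Proof. by case=> n n_gt0 an0; exists n => //; rewrite -starX an0 star0. Qed.

Lemma mulr_star_eq0 (R : starRingType) (a b : R) :
  a * star b = 0 <-> b * star a = 0.
Proof.
by split=> /(congr1 star); rewrite starM starK star0.
Qed.

Theorem theorem4p4 (R : starRingType) :
  nil_star_reversible R <->
  (forall a : R, nilpotents a ->
     lann a = lann (star a) /\ lann (star a) = rann a).
Proof.
split=> [rev a nil_a | ann a b nil_a ab0].
- have rannE x : a * x = 0 <-> x * star a = 0.
    rewrite -mulr_star_eq0; split=> [/(rev _ _ nil_a)[]//|].
    by move/(rev _ _ nil_a); rewrite starK; case.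
  split; apply/seteqP; split=> x /=; rewrite /lann /rann /=.
  (* Reversibility at [star a], as [a] stands on the right in [x * a = 0]. *)
  + move=> /(congr1 star); rewrite starM star0.
    by move/(rev _ _ (nilpotents_star _ _ nil_a)); rewrite starK; case.
  + by move/mulr_star_eq0/(rev _ _ nil_a); rewrite starK; case.
  + by move/rannE.
  + by move/rannE.
- have [lannE rannE] := ann a nil_a.
  have abs0 : a * star b = 0.
    by apply/mulr_star_eq0; change (lann (star a) b); rewrite rannE.
  by split=> //; change (lann a (star b)); rewrite lannE rannE.
Qed.
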